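(* Let $\mathscr{A}=(a_{ijkl})\in\mathbb{T}_{4,3}$ be a paired symmetric tensor (in particular, possibly an elasticity tensor). If the biquadratic form $\mathscr{A}x^2y^2$ is a sum of squares of bilinear forms, then $a_{iikk}\ge0$ for all $i,k\in\{1,2,3\}$.
   Context: $\mathbb{T}_{4,3}$ is the set of real tensors $\mathscr{A}=(a_{ijkl})$ with $i,j,k,l\in\{1,2,3\}$. $\mathscr{A}$ is paired symmetric if $a_{ijkl}=a_{jikl}=a_{ijlk}=a_{jilk}$ for all indices; it is an elasticity tensor if moreover $a_{ijkl}=a_{klij}$ for all indices. For $x,y\in\mathbb{R}^3$, $\mathscr{A}x^2y^2:=\sum_{i,j,k,l=1}^3a_{ijkl}x_ix_jy_ky_l$; it is a sum of squares of bilinear forms if it equals $\sum_{s=1}^r\big(\sum_{i,j=1}^3\alpha^s_{ij}x_iy_j\big)^2$ identically for some $r\ge1$ and real $\alpha^s_{ij}$. *)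

(* Defs.v *)
From HB Require Import structures.
From mathcomp Require Import all_boot all_order all_algebra.
From mathcomp Require Import reals.

Set Implicit Arguments.
Unset Strict Implicit.
Unset Printing Implicit Defensive.

Import Order.TTheory GRing.Theory Num.Theory.
Local Open Scope ring_scope.

(* The indices 1, 2, 3 are represented by 0, 1, 2 : 'I_3. *)
Definition tensor43 (R : realType) : Type := 'I_3 -> 'I_3 -> 'I_3 -> 'I_3 -> R.

Definition paired_symmetric (R : realType) (A : tensor43 R) : Prop :=
  forall i j k l : 'I_3,
    [/\ A i j k l = A j i k l, A i j k l = A i j l k & A i j k l = A j i l k].

Definition biquadratic_form (R : realType) (A : tensor43 R)
    (x y : 'rV[R]_3) : R :=
  \sum_(i < 3) \sum_(j < 3) \sum_(k < 3) \sum_(l < 3)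
    A i j k l * x 0 i * x 0 j * y 0 k * y 0 l.

Definition bilinear_form (R : realType) (M : 'M[R]_3) (x y : 'rV[R]_3) : R :=
  \sum_(i < 3) \sum_(j < 3) M i j * x 0 i * y 0 j.

Definition sum_of_squares_of_bilinear_forms (R : realType)
    (f : 'rV[R]_3 -> 'rV[R]_3 -> R) : Prop :=
  exists (r : nat) (alpha : 'I_r -> 'M[R]_3), (0 < r)%N /\
    forall x y : 'rV[R]_3,
      f x y = \sum_(s < r) bilinear_form (alpha s) x y ^+ 2.

(* Main.v *)
Require Import Defs.
From HB Require Import structures.
From mathcomp Require Import all_boot all_order all_algebra.
From mathcomp Require Import reals.

Set Implicit Arguments.
Unset Strict Implicit.
Unset Printing Implicit Defensive.

Import Order.TTheory GRing.Theory Num.Theory.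
Local Open Scope ring_scope.

(** A sum of squares is nonnegative at every pair of vectors, and the entry [A i i k k] is itself a
    value of the biquadratic form, namely at the standard basis vectors x = e_i, y = e_k.
    [biquadratic_form_delta] supplies this evaluation. *)

Lemma biquadratic_form_delta (R : realType) (A : tensor43 R) (i k : 'I_3) :
  biquadratic_form A (delta_mx 0 i) (delta_mx 0 k) = A i i k k.
Proof.
rewrite /biquadratic_form.
have sum1 (F : 'I_3 -> R) (a : 'I_3) :
    (forall b, b != a -> F b = 0) -> \sum_(b < 3) F b = F a.
  by move=> F0; rewrite (bigD1 a) //= big1 ?addr0.
have delta0 (a b : 'I_3) : b != a -> (delta_mx 0 a : 'rV[R]_3) 0 b = 0.
  by move=> ba; rewrite mxE (negbTE ba) andbF.
(* The four nested sums collapse from the outside in: the two x-indices to [i], the two y-indices to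
   [k]. Off these indices a basis-vector coordinate kills every term. *)
rewrite (sum1 _ i) => [|a ai]; last first.
  by do 3 (rewrite big1 // => ? _); rewrite (delta0 _ _ ai) mulr0 !mul0r.
rewrite (sum1 _ i) => [|a ai]; last first.
  by do 2 (rewrite big1 // => ? _); rewrite (delta0 _ _ ai) mulr0 !mul0r.
rewrite (sum1 _ k) => [|a ak]; last first.
  by rewrite big1 // => ? _; rewrite (delta0 _ _ ak) mulr0 mul0r.
rewrite (sum1 _ k) => [|a ak]; last by rewrite (delta0 _ _ ak) mulr0.
by rewrite !mxE !eqxx !mulr1.
Qed.

Theorem theorem5p10 (R : realType) (A : tensor43 R)
    (hA : paired_symmetric A)
    (hsos : sum_of_squares_of_bilinear_forms (biquadratic_form A)) :
  forall i k : 'I_3, 0 <= A i i k k.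
Proof.
move=> i k; case: hsos => r [alpha [_ sos]].
(* Read backwards, the evaluation turns the entry into a value of the form, to which the
   decomposition applies. *)
rewrite -biquadratic_form_delta sos.
by apply: sumr_ge0 => s _; apply: sqr_ge0.
Qed.
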